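(* Suppose $\langle\cdot,\cdot\rangle$ is symmetric and $r\ge 1$. Then $U(r;V)\subseteq\mathrm{End}_k(V)^r$ is a dense open subvariety.
   Context: $k$ is an algebraically closed field of characteristic different from $2$; $n,r$ are positive integers; $V=k^n$ is equipped with a nondegenerate bilinear form $\langle\cdot,\cdot\rangle$ (here symmetric). $\rho$ is the adjoint involution on $\mathrm{End}_k(V)$, determined by $\langle\rho(A)v,w\rangle=\langle v,Aw\rangle$ for all $v,w\in V$. An $r$-tuple $A_\bullet=(A_1,\dots,A_r)\in\mathrm{End}_k(V)^r$ generates $\mathrm{End}_k(V)$ as an algebra with involution if every $B\in\mathrm{End}_k(V)$ is a noncommutative polynomial over $k$ in the $A_i$ and $\rho(A_i)$. $U(r;V)\subseteq\mathrm{End}_k(V)^r$ is the set of $r$-tuples that generate $\mathrm{End}_k(V)$ as an algebra with involution. $\mathrm{End}_k(V)^r$ is identified with affine space $\mathbb{A}^{n^2r}_k$ with its Zariski topology. *)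

(* Defs.v *)
From HB Require Import structures.
From mathcomp Require Import all_boot all_order all_algebra.
From mathcomp Require Import all_classical topology.
From mathcomp Require Import mpoly.

Set Implicit Arguments.
Unset Strict Implicit.
Unset Printing Implicit Defensive.

Import GRing.Theory.
Local Open Scope classical_set_scope.
Local Open Scope ring_scope.

Definition zero_locus (k : fieldType) (N : nat) (S : set {mpoly k[N]}) :
    set 'rV[k]_N :=
  [set x | forall p, S p -> p.@[fun i => x 0 i] = 0].

Definition zariski_open (k : fieldType) (N : nat) : set (set 'rV[k]_N) :=
  [set U | exists S : set {mpoly k[N]}, ~` U = zero_locus S].

Section ZariskiTopology.
Variables (k : fieldType) (N : nat).

Lemma zariski_openT : zariski_open (setT : set 'rV[k]_N).
Proof.
exists setT; rewrite setCT; apply/seteqP; split=> // x /(_ 1 Logic.I).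
by rewrite rmorph1 => /eqP; rewrite oner_eq0.
Qed.

Lemma zariski_openI : setI_closed (@zariski_open k N).
Proof.
move=> U V [S HS] [T HT].
exists [set p | exists q s, [/\ S q, T s & p = q * s]].
rewrite setCI HS HT; apply/seteqP; split=> x /=.
- case=> H _ [q [s [Sq Ts ->]]]; rewrite mevalM.
  + by rewrite (H q Sq) mul0r.
  + by rewrite (H s Ts) mulr0.
- move=> H; apply: contrapT => /not_orP[nS nT].
  move/existsNP: nS => [q /not_implyP[Sq /eqP nq]].
  move/existsNP: nT => [s /not_implyP[Ts /eqP ns]].
  have /eqP := H (q * s) (ex_intro _ q (ex_intro _ s (And3 Sq Ts erefl))).
  by rewrite mevalM mulf_eq0 (negPf nq) (negPf ns).
Qed.

Lemma zariski_open_bigU (I : Type) (f : I -> set 'rV[k]_N) :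
  (forall i, zariski_open (f i)) -> zariski_open (\bigcup_i f i).
Proof.
move=> /choice[S HS]; exists (\bigcup_i S i).
rewrite setC_bigcup; apply/seteqP; split=> x /=.
- by move=> H p [i _ Sp]; have := H i Logic.I; rewrite HS; apply.
- by move=> H i _; rewrite HS => p Sp; apply: H; exists i.
Qed.

End ZariskiTopology.

Definition affine_space (k : fieldType) (N : nat) : Type := 'rV[k]_N.

HB.instance Definition _ (k : fieldType) (N : nat) :=
  Choice.on (affine_space k N).
HB.instance Definition _ (k : fieldType) (N : nat) :=
  isOpenTopological.Build (affine_space k N)
    (@zariski_openT k N) (@zariski_openI k N) (@zariski_open_bigU k N).

(* V is 'cV[k]_n and End(V) is 'M[k]_n, acting by v |-> A *m v. *)
Definition entries (k : fieldType) (n r : nat) (A : 'I_r -> 'M[k]_n) :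
    affine_space k (r * (n * n)) :=
  mxvec (\matrix_(i < r) mxvec (A i)).

Lemma entries_bij (k : fieldType) (n r : nat) : bijective (@entries k n r).
Proof.
exists (fun x i => vec_mx (row i (vec_mx (x : 'rV_(r * (n * n)))))).
- by move=> A; apply/funext => i; rewrite mxvecK rowK mxvecK.
- move=> x; rewrite /entries -[RHS]vec_mxK; congr mxvec.
  by apply/row_matrixP => i; rewrite rowK vec_mxK.
Qed.

Definition is_adjoint_involution (k : fieldType) (n : nat)
    (form : 'cV[k]_n -> 'cV[k]_n -> k) (rho : 'M[k]_n -> 'M[k]_n) : Prop :=
  forall (A : 'M[k]_n) (v w : 'cV[k]_n), form (rho A *m v) w = form v (A *m w).

Lemma gram_matrixE (k : fieldType) (n : nat) (form : {symmetric 'cV[k]_n})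
    (v w : 'cV[k]_n) :
  form v w =
    (v^T *m (\matrix_(i, j) form (delta_mx i 0) (delta_mx j 0)) *m w) 0 0.
Proof.
have dec (u : 'cV[k]_n) : u = \sum_i u i 0 *: delta_mx i 0.
  by rewrite {1}[u]matrix_sum_delta; apply: eq_bigr => i _; rewrite big_ord1.
rewrite {1}[v]dec {1}[w]dec linear_sumr /= mxE; apply: eq_bigr => j _.
rewrite linearZr_LR /= linear_sumlz /= mulrC mxE; congr (_ * _).
by apply: eq_bigr => i _; rewrite linearZl_LR /= !mxE.
Qed.

(* So the hypothesis [is_adjoint_involution form rho] determines [rho] and is
   always satisfiable. *)
Lemma adjoint_involution_unique_exists (k : fieldType) (n : nat)
    (form : {symmetric 'cV[k]_n}) :
  nondegenerate form -> exists! rho, is_adjoint_involution form rho.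
Proof.
move=> nd; pose G : 'M[k]_n := \matrix_(i, j) form (delta_mx i 0) (delta_mx j 0).
have fE v w : form v w = (v^T *m G *m w) 0 0 by rewrite gram_matrixE.
have sep v : (forall w, form v w = 0) -> v = 0.
  move=> v0; have: v \in orthov form fullv by apply/mem_orthovP => w _.
  by rewrite (eqP nd) memv0 => /eqP.
have Gu : G \in unitmx.
  rewrite -row_free_unit -kermx_eq0; apply/eqP/row_matrixP => i; rewrite row0.
  apply: trmx_inj; rewrite trmx0; apply: sep => w.
  by rewrite fE trmxK -row_mul mulmx_ker row0 mul0mx mxE.
have adj A v w : form ((G *m A *m invmx G)^T *m v) w = form v (A *m w).
  by rewrite !fE trmx_mul trmxK -!mulmxA mulKmx.
exists (fun A => (G *m A *m invmx G)^T); split=> // rho Hrho.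
apply/funext => A; apply/trmx_inj/row_matrixP => i.
rewrite -!tr_col !colE; congr trmx; apply/subr0_eq; apply: sep => w.
rewrite linearBl; apply/eqP; rewrite subr_eq0; apply/eqP.
exact: etrans (adj A _ _) (esym (Hrho A _ _)).
Qed.

(* [mpoly] and [monalg] share many names: from here on [msupp] and [mcoeff]
   are those of [monalg]. *)
From mathcomp Require Import finmap monalg.

(* Noncommutative polynomials over k in the letters X form the algebra
   {malg k[{fmonom X}]} of the free monoid on X; the empty word evaluates
   to the identity matrix. *)
Definition ncpoly_eval (k : fieldType) (n : nat) (X : choiceType)
    (a : X -> 'M[k]_n) (p : {malg k[{fmonom X}]}) : 'M[k]_n :=
  \sum_(w <- msupp p) mcoeff w p *: \prod_(x <- (w : seq X)) a x.

Definition generates_with_involution (k : fieldType) (n r : nat)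
    (rho : 'M[k]_n -> 'M[k]_n) (A : 'I_r -> 'M[k]_n) : Prop :=
  forall B : 'M[k]_n, exists p : {malg k[{fmonom ('I_r + 'I_r)%type}]},
    B = ncpoly_eval
          (fun x => match x with inl i => A i | inr i => rho (A i) end) p.

Definition U (k : fieldType) (n r : nat) (rho : 'M[k]_n -> 'M[k]_n) :
    set ('I_r -> 'M[k]_n) :=
  [set A | generates_with_involution rho A].
Arguments U {k n} r rho.

(* Main.v *)
Require Import Defs.
From HB Require Import structures.
From mathcomp Require Import all_boot all_order all_algebra.
From mathcomp Require Import all_classical topology.
From mathcomp Require Import mpoly.
From mathcomp Require Import finmap.
From mathcomp Require monalg.

Set Implicit Arguments.
Unset Strict Implicit.
Unset Printing Implicit Defensive.

Import GRing.Theory.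
Local Open Scope classical_set_scope.
Local Open Scope ring_scope.

(** A tuple generates exactly when the words in the A_i and rho(A_i) span
    End(V), that is, when some n^2 words are linearly independent
    ([generates_words_det]).  Let G be the Gram matrix of the form.  Since
    rho(A) = (G A G^-1)^T has entries linear in those of A ([adjointE]), the
    determinant formed by n^2 given words is a polynomial [word_det] in the
    entries of the tuple ([meval_word_det]).  Hence U is the set where at least
    one of these polynomials does not vanish, and it is open.

    An affine space over an algebraically closed field is irreducible
    ([dense_open_nonempty]), so density reduces to finding one generating
    tuple, for which one matrix A, repeated r times, is enough.  In an
    orthogonal basis, where G = diag(d) with all d_j nonzero
    ([diagonalize_symmetric], which needs 2 to be invertible), rho maps A to
    G^-1 A^T G.  Take A = S + K with S diagonal with distinct entries and K
    anti-self-adjoint with all off-diagonal entries nonzero.  Then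
    rho(A) = S - K, so A and rho(A) generate both S and K.  Polynomials in S
    give the diagonal matrix units E_ii, and E_ii K E_jj is a nonzero multiple
    of E_ij ([subalgebra_full]): everything is generated.  The entries
    K_ij = d_j for i < j and K_ij = - d_j for i > j are a suitable choice
    ([exists_generating_pair]). *)

(** * Zariski topology of affine space *)

Lemma open_nonvanishing (k : fieldType) (N : nat) (S : set {mpoly k[N]}) :
  open ([set x | exists2 p, S p & p.@[fun i => x 0 i] != 0]
        : set (affine_space k N)).
Proof.
exists S; apply/seteqP; split=> x /= Hx.
  by move=> p Sp; apply/eqP/negPn/negP => px; apply: Hx; exists p.
by case=> p Sp; rewrite Hx // eqxx.
Qed.

Definition restrict_to_line (k : fieldType) (N : nat) (x y : 'rV[k]_N) :
    {mpoly k[N]} -> {poly k} :=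
  mpoly.mmap polyC (fun i => (x 0 i)%:P + (y 0 i - x 0 i) *: 'X).

Lemma horner_restrict_to_line (k : fieldType) (N : nat) (x y : 'rV[k]_N)
    (p : {mpoly k[N]}) (t : k) :
  (restrict_to_line x y p).[t] = p.@[fun i => (x + t *: (y - x)) 0 i].
Proof.
rewrite /restrict_to_line /mpoly.mmap mevalE horner_sum.
apply: eq_bigr => m _; rewrite hornerM hornerC; congr (_ * _).
rewrite /mmap1 horner_prod; apply: eq_bigr => i _.
by rewrite horner_exp !hornerE /= !mxE [t * _]mulrC.
Qed.

(** Irreducibility by restriction to a line: if p is nonzero at x and q is
    nonzero at y, their restrictions to the line through x and y are nonzero
    univariate polynomials, and so is the product, which therefore has a
    non-root on that line. *)
Lemma dense_open_nonempty (k : closedFieldType) (N : nat)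
    (V : set (affine_space k N)) : open V -> V !=set0 -> dense V.
Proof.
case=> S SV [x Vx] O [y Oy] [T TO].
have [p Sp px] : exists2 p, S p & p.@[fun i => x 0 i] != 0.
  apply: contrapT => nex; suff: (~` V) x by [].
  rewrite SV => p Sp; apply/eqP/negPn/negP => px; apply: nex; by exists p.
have [q Tq qy] : exists2 q, T q & q.@[fun i => y 0 i] != 0.
  apply: contrapT => nex; suff: (~` O) y by [].
  rewrite TO => q Tq; apply/eqP/negPn/negP => qy; apply: nex; by exists q.
pose f := restrict_to_line x y.
have f0 : (f p).[0] = p.@[fun i => x 0 i].
  by rewrite horner_restrict_to_line scale0r addr0.
have f1 : (f q).[1] = q.@[fun i => y 0 i].
  by rewrite horner_restrict_to_line scale1r addrC subrK.
have fp0 : f p != 0.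
  by apply: contraNneq px => fp0; rewrite -f0 fp0 horner0.
have fq0 : f q != 0.
  by apply: contraNneq qy => fq0; rewrite -f1 fq0 horner0.
have /closed_nonrootP[t] : f p * f q != 0 by rewrite mulf_neq0.
rewrite rootM negb_or /root !horner_restrict_to_line => /andP[pt qt].
exists (x + t *: (y - x)); split; apply: contrapT => nz.
  suff: (~` O) (x + t *: (y - x)) by rewrite TO => /(_ _ Tq)/eqP; apply/negP.
  by [].
suff: (~` V) (x + t *: (y - x)) by rewrite SV => /(_ _ Sp)/eqP; apply/negP.
by [].
Qed.

(** * Words and the algebra they span *)

Definition word_mx (R : pzRingType) (n : nat) (X : Type) (a : X -> 'M[R]_n)
  (w : seq X) : 'M[R]_n := \prod_(x <- w) a x.

Lemma map_word_mx (R S : pzRingType) (f : {rmorphism R -> S}) (n : nat)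
    (X : Type) (a : X -> 'M[R]_n) (w : seq X) :
  map_mx f (word_mx a w) = word_mx (fun x => map_mx f (a x)) w.
Proof.
rewrite /word_mx; elim: w => [|x w IH]; first by rewrite !big_nil map_mx1.
by rewrite !big_cons map_mxM IH.
Qed.

(** A Prop-valued predicate, because the algebra generated by a tuple is given
    by an existential over noncommutative polynomials. *)
Record subalgebra (k : fieldType) (n : nat) (T : set 'M[k]_n) : Prop :=
  Subalgebra {
    subalgebra1 : T 1%:M;
    subalgebraD : forall A B, T A -> T B -> T (A + B);
    subalgebraZ : forall c A, T A -> T (c *: A);
    subalgebraM : forall A B, T A -> T B -> T (A *m B) }.

Lemma subalgebra_sum (k : fieldType) (n : nat) (T : set 'M[k]_n) (I : Type)
    (s : seq I) (F : I -> 'M[k]_n) :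
  subalgebra T -> (forall i, T (F i)) -> T (\sum_(i <- s) F i).
Proof.
move=> algT TF; apply: (big_ind T) => //; last exact: (subalgebraD algT).
by rewrite -(scale0r 1%:M); apply: (subalgebraZ algT); apply: subalgebra1.
Qed.

Section NcpolyEval.
Import monalg.
Variables (k : fieldType) (n : nat) (X : choiceType) (a : X -> 'M[k]_n).

(** Summing over any finite set of words that contains the support lets two
    polynomials be compared over a common index set. *)
Lemma ncpoly_evalEw (d : {fset {fmonom X}}) (p : {malg k[{fmonom X}]}) :
  (msupp p `<=` d)%fset ->
  ncpoly_eval a p = \sum_(w <- d) mcoeff w p *: word_mx a w.
Proof.
move=> pd; rewrite /ncpoly_eval (big_fset_incl _ pd) // => w _ wp.
by rewrite mcoeff_outdom // scale0r.
Qed.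

Lemma ncpoly_evalD (p q : {malg k[{fmonom X}]}) :
  ncpoly_eval a (p + q) = ncpoly_eval a p + ncpoly_eval a q.
Proof.
rewrite !(@ncpoly_evalEw (msupp p `|` msupp q)%fset)
  ?fsubsetUl ?fsubsetUr ?msuppD_le //.
by rewrite -big_split; apply: eq_bigr => w _; rewrite mcoeffD scalerDl.
Qed.

Lemma ncpoly_evalZ (c : k) (p : {malg k[{fmonom X}]}) :
  ncpoly_eval a (c *: p) = c *: ncpoly_eval a p.
Proof.
rewrite !(@ncpoly_evalEw (msupp p)) ?msuppZ_le // scaler_sumr.
by apply: eq_bigr => w _; rewrite mcoeffZ scalerA.
Qed.

Lemma ncpoly_eval_word (w : seq X) :
  range (ncpoly_eval a) (word_mx a w).
Proof.
exists (<< 1 *g FMonom w >>) => //.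
rewrite (ncpoly_evalEw (msuppU_le)) big_seq_fset1.
by rewrite mcoeffUU scale1r.
Qed.

Lemma subalgebra_ncpoly_eval : subalgebra (range (ncpoly_eval a)).
Proof.
have addT B C : range (ncpoly_eval a) B -> range (ncpoly_eval a) C ->
    range (ncpoly_eval a) (B + C).
  by move=> [p _ <-] [q _ <-]; exists (p + q) => //; apply: ncpoly_evalD.
have scaleT c B : range (ncpoly_eval a) B -> range (ncpoly_eval a) (c *: B).
  by move=> [p _ <-]; exists (c *: p) => //; apply: ncpoly_evalZ.
have T0 : range (ncpoly_eval a) 0.
  rewrite -(scale0r (word_mx a [::])).
  by apply: scaleT; exact: ncpoly_eval_word.
split=> //.
  by have := ncpoly_eval_word [::]; rewrite /word_mx big_nil.
move=> _ _ [p _ <-] [q _ <-]; rewrite mulmx_suml.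
apply: (big_ind (range (ncpoly_eval a))) => // u _.
rewrite mulmx_sumr; apply: (big_ind (range (ncpoly_eval a))) => // v _.
rewrite -scalemxAl -scalemxAr; do 2!apply/scaleT.
by have := ncpoly_eval_word (u ++ v); rewrite /word_mx big_cat.
Qed.

(** A noncommutative polynomial has finite support, so if the algebra is
    everything, the n^2 matrix units already lie in the span of finitely many
    words; n^2 linearly independent ones can be extracted from these. *)
Lemma generates_words_det :
  (forall B, exists p, B = ncpoly_eval a p) <->
  exists w : 'I_(n * n) -> seq X,
    \det (\matrix_t mxvec (word_mx a (w t))) != 0.
Proof.
split=> [gen|[w]]; last first.
  rewrite -unitfE -[_ \is a _]/(_ \in unitmx) -row_full_unit.
  case/row_fullP=> L LM B.
  suff [p _ <-] : range (ncpoly_eval a) B by exists p.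
  rewrite -(mxvecK B) -[mxvec B]mulmx1 -LM mulmxA mulmx_sum_row linear_sum.
  apply: (subalgebra_sum _ subalgebra_ncpoly_eval) => t.
  rewrite linearZ /= rowK mxvecK.
  by apply/(subalgebraZ subalgebra_ncpoly_eval)/ncpoly_eval_word.
have /choice[p Hp] (t : 'I_(n * n)) := gen (vec_mx (delta_mx 0 t)).
pose ws := flatten [seq (msupp (p t) : seq {fmonom X}) | t <- enum 'I_(n * n)].
pose M := \matrix_(i < size ws)
  mxvec (word_mx a (nth (FMonom [::]) ws i : {fmonom X})).
(* The rows of M are all the words used to write the matrix units. *)
have Mfull : row_full M.
  rewrite -sub1mx; apply/row_subP => t.
  rewrite rowE mulmx1 -[delta_mx 0 t]vec_mxK (Hp t) /ncpoly_eval linear_sum.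
  rewrite big_seq; apply: summx_sub => w wp.
  rewrite linearZ scalemx_sub //.
  have wws : w \in ws.
    by apply/flattenP; exists (enum_fset (msupp (p t))) => //;
      apply: map_f; rewrite mem_enum.
  move: (wws); rewrite -index_mem => lt_w.
  by rewrite (eq_row_sub (Ordinal lt_w)) // rowK /= nth_index.
exists (fun t => (nth (FMonom [::]) ws (fullrankfun Mfull t) : {fmonom X})).
rewrite -unitfE -[_ \is a _]/(_ \in unitmx) -row_full_unit.
congr row_full: (fullrowsub_full Mfull).
by apply/row_matrixP => t; rewrite row_rowsub !rowK.
Qed.

End NcpolyEval.

(** * Subalgebras containing a diagonal matrix with distinct entries *)

Lemma subalgebra_diag_horner (k : fieldType) (n : nat) (T : set 'M[k]_n)
    (s : 'rV[k]_n) (f : {poly k}) :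
  subalgebra T -> T (diag_mx s) -> T (diag_mx (\row_j f.[s 0 j])).
Proof.
move=> algT Ts; elim/poly_ind: f => [|f c IH].
  rewrite (_ : diag_mx _ = 0 *: 1%:M); last first.
    by rewrite scale0r; apply/matrixP => i j; rewrite !mxE horner0 mul0rn.
  exact/(subalgebraZ algT)/(subalgebra1 algT).
rewrite (_ : diag_mx _ =
  diag_mx (\row_j f.[s 0 j]) *m diag_mx s + c *: 1%:M); last first.
  rewrite mulmx_diag scalemx1; apply/matrixP => i j.
  by rewrite !mxE -mulrnDl !hornerE.
apply: (subalgebraD algT); first exact: (subalgebraM algT).
exact/(subalgebraZ algT)/(subalgebra1 algT).
Qed.

(** The diagonal matrix units are the values at S of the Lagrange polynomials
    of its distinct entries, and E_ii K E_jj = K_ij E_ij. *)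
Lemma subalgebra_full (k : fieldType) (n : nat) (T : set 'M[k]_n)
    (s : 'rV[k]_n) (K : 'M[k]_n) :
  subalgebra T -> injective (s 0) -> (forall i j, i != j -> K i j != 0) ->
  T (diag_mx s) -> T K -> forall B, T B.
Proof.
move=> algT s_inj K0 Ts TK.
have Tdiag i : T (delta_mx i i).
  pose f := \prod_(l | l != i) ('X - (s 0 l)%:P).
  have fi : f.[s 0 i] != 0.
    rewrite horner_prod; apply/prodf_neq0 => l li.
    by rewrite !hornerE subr_eq0 (inj_eq s_inj) eq_sym.
  have fl l : l != i -> f.[s 0 l] = 0.
    by move=> li; rewrite horner_prod (bigD1 l) //= !hornerE subrr mul0r.
  rewrite (_ : delta_mx i i = f.[s 0 i]^-1 *: diag_mx (\row_j f.[s 0 j])).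
    by apply: (subalgebraZ algT); apply: subalgebra_diag_horner.
  apply/matrixP => u v; rewrite !mxE; have [->|uv] := eqVneq u v; last first.
    rewrite mulr0n mulr0; case: eqP => // ui; case: eqP => // vi.
    by rewrite ui vi eqxx in uv.
  rewrite andbb mulr1n; have [->|/fl->] := eqVneq v i; last by rewrite mulr0.
  by rewrite mulVf.
have Tdelta i j : T (delta_mx i j).
  have [->|/K0 Kij] := eqVneq i j; first exact: Tdiag.
  rewrite (_ : delta_mx i j = (K i j)^-1 *: (delta_mx i i *m K *m delta_mx j j)).
    by do ?[apply: (subalgebraZ algT) | apply: (subalgebraM algT)].
  have KE : delta_mx (0 : 'I_1) i *m K *m delta_mx j (0 : 'I_1) = (K i j)%:M.
    by rewrite -rowE -colE [LHS]mx11_scalar !mxE.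
  rewrite -(mul_delta_mx (0 : 'I_1) i i) -(mul_delta_mx (0 : 'I_1) j j).
  rewrite -(mul_delta_mx (0 : 'I_1) i j) !mulmxA.
  rewrite -(mulmxA _ _ K) -(mulmxA _ _ (delta_mx j 0)) KE mul_mx_scalar.
  by rewrite -scalemxAl scalerA mulVf // scale1r.
move=> B; rewrite [B]matrix_sum_delta.
do 2![apply: subalgebra_sum => // ?].
exact/(subalgebraZ algT).
Qed.

(** * Orthogonal bases of symmetric forms *)

(** By polarization: b(e_i + e_j, e_i + e_j) = 2 b(e_i, e_j) if e_i and e_j are
    isotropic, so a symmetric form without anisotropic vectors is zero. *)
Lemma symmetric_anisotropic (k : fieldType) (n : nat) (G : 'M[k]_n) :
  2%:R != 0 :> k -> G^T = G -> G != 0 ->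
  exists v : 'rV[k]_n, (v *m G *m v^T) 0 0 != 0.
Proof.
move=> two0 symG G0; apply: contrapT => iso.
have q0 (v : 'rV[k]_n) : v *m G *m v^T = 0.
  rewrite [LHS]mx11_scalar; apply/eqP; apply: contrapT => /negP vGv.
  by apply: iso; exists v; apply: contraNneq vGv => ->; rewrite raddf0.
case/eqP: G0; apply/matrixP => i j; rewrite [RHS]mxE.
pose b (u v : 'rV[k]_n) := (u *m G *m v^T) 0 0.
have bE u v : b (delta_mx 0 u) (delta_mx 0 v) = G u v.
  by rewrite /b trmx_delta -rowE -colE !mxE.
have : b (delta_mx 0 i + delta_mx 0 j) (delta_mx 0 i + delta_mx 0 j) = 0.
  by rewrite /b q0 mxE.
rewrite /b linearD /= !mulmxDl !mulmxDr !q0 add0r addr0 mxE -!/(b _ _) !bE.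
rewrite -[G i j in X in X -> _]/(G i j) -{2}symG mxE -mulr2n -mulr_natl => /eqP.
by rewrite mulf_eq0 (negPf two0) => /eqP.
Qed.

(** An anisotropic vector can be made the first vector of a basis. *)
Lemma symmetric_corner_neq0 (k : fieldType) (n : nat) (G : 'M[k]_n.+1) :
  2%:R != 0 :> k -> G^T = G -> G != 0 ->
  exists2 R, R \in unitmx & (R *m G *m R^T) 0 0 != 0.
Proof.
move=> two0 symG G0; have [v vGv] := symmetric_anisotropic two0 symG G0.
have rkv : \rank v = 1%N.
  apply/eqP; rewrite eqn_leq rank_leq_row lt0n mxrank_eq0.
  by apply: contraNneq vGv => ->; rewrite !mul0mx mxE.
exists (row_ebase v); first exact: row_ebase_unit.
have [c vE] : exists c, v = c *: row 0 (row_ebase v).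
  exists (col_ebase v 0 0); rewrite -{1}(mulmx_ebase v) rkv.
  rewrite [col_ebase v]mx11_scalar mul_scalar_mx -scalemxAl.
  congr (_ *: _); first by rewrite mxE eqxx mulr1n.
  (* Here v = c e_0 R, as the matrix of v has rank 1. *)
  rewrite rowE; congr (_ *m _); apply/rowP => j; rewrite !mxE.
  by rewrite /= eq_sym andbT.
move: (row_ebase v) vE => R vE; apply: contraNneq vGv => a0.
have : (row 0 R *m G *m (row 0 R)^T) 0 0 = (R *m G *m R^T) 0 0.
  rewrite tr_row -row_mul [LHS]mxE [RHS]mxE; apply: eq_bigr => l _.
  by congr (_ * _); rewrite [LHS]mxE.
rewrite vE a0 linearZ /= -!scalemxAl -scalemxAr => h.
by rewrite 2!mxE [X in _ * (_ * X)]h !mulr0.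
Qed.

Lemma schur_complement (k : fieldType) (n : nat) (G : 'M[k]_(1 + n)) :
  G^T = G -> G 0 0 != 0 ->
  exists L S, [/\ L \in unitmx, S^T = S &
    L *m G *m L^T = block_mx (G 0 0)%:M 0 0 S].
Proof.
move=> symG; set a := G 0 0 => a0.
pose c := dlsubmx G.
have GE : G = block_mx a%:M c^T c (drsubmx G).
  rewrite -[LHS]submxK; congr block_mx; last by rewrite /c trmx_dlsub symG.
  rewrite [LHS]mx11_scalar !mxE; congr (G _ _)%:M; exact: val_inj.
(* Each basis vector but the first is replaced by its projection orthogonal to
   the first one. *)
exists (block_mx 1%:M 0 (- a^-1 *: c) 1%:M).
exists (drsubmx G - a^-1 *: (c *m c^T)); split.
- by rewrite unitmxE det_lblock !det1 mulr1 unitr1.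
- by rewrite linearB linearZ /= trmx_mul trmxK trmx_drsub symG.
have ca : - a^-1 *: c *m a%:M + c = 0.
  by rewrite mul_mx_scalar scalerA mulrN divff // scaleN1r addNr.
rewrite {1}GE tr_block_mx !trmx1 trmx0 !mulmx_block.
rewrite !mul1mx !mul0mx !mulmx1 !mulmx0 !addr0 ca mul0mx add0r.
congr block_mx.
  by rewrite linearZ /= mul_scalar_mx scalerA mulrN divff // scaleN1r addNr.
by rewrite -scalemxAl scaleNr addrC.
Qed.

(** Existence of an orthogonal basis, the rows of P: split off an anisotropic
    vector and recurse on its orthogonal complement. *)
Lemma diagonalize_symmetric (k : fieldType) (n : nat) (G : 'M[k]_n) :
  2%:R != 0 :> k -> G^T = G ->
  exists P d, P \in unitmx /\ P *m G *m P^T = diag_mx d.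
Proof.
move=> two0; elim: n G => [|n IH] G symG.
  by exists 1%:M, 0; split; [exact: unitmx1 | apply/matrixP => -[]].
have [->|G0] := eqVneq G 0.
  by exists 1%:M, 0; rewrite unitmx1 mulmx0 mul0mx raddf0.
have [R Ru a0] := symmetric_corner_neq0 two0 symG G0.
have symRG : (R *m G *m R^T)^T = R *m G *m R^T.
  by rewrite !trmx_mul trmxK symG mulmxA.
have [L [S [Lu symS LE]]] := @schur_complement k n _ symRG a0.
have [P [d [Pu PE]]] := IH S symS.
pose Q : 'M[k]_(1 + n) := block_mx 1%:M 0 0 P.
have Qu : Q \in unitmx by rewrite unitmxE det_ublock det1 mul1r -unitmxE.
exists (Q *m L *m R), (row_mx ((R *m G *m R^T) 0 0)%:M d); split.
  by rewrite !unitmx_mul Ru Lu !andbT.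
have -> : Q *m L *m R *m G *m (Q *m L *m R)^T =
    Q *m (L *m (R *m G *m R^T) *m L^T) *m Q^T.
  by rewrite !trmx_mul !mulmxA.
rewrite LE tr_block_mx !trmx0 trmx1 !mulmx_block.
rewrite !mul1mx !mul0mx !mulmx0 !mulmx1 !addr0 !add0r !mul0mx PE.
have diag1 (a : k) : diag_mx (a%:M : 'rV_1) = a%:M.
  by rewrite [LHS]mx11_scalar !mxE eqxx !mulr1n.
by rewrite [RHS](diag_mx_row (((R *m G *m R^T) 0 0)%:M : 'rV_1) d) diag1.
Qed.

(** * Adjoints *)

Section Adjoint.
Variables (k : fieldType) (n : nat) (form : {symmetric 'cV[k]_n}).
Hypothesis hform : nondegenerate form.

Definition gram : 'M[k]_n := \matrix_(i, j) form (delta_mx i 0) (delta_mx j 0).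

Lemma form_gram (v w : 'cV[k]_n) : form v w = (v^T *m gram *m w) 0 0.
Proof. exact: gram_matrixE. Qed.

Lemma gram_sym : gram^T = gram.
Proof. by apply/matrixP => i j; rewrite !mxE hermC /= expr0 mul1r. Qed.

Lemma form_eq0 (v : 'cV[k]_n) : (forall w, form v w = 0) -> v = 0.
Proof.
move=> v0; have : v \in orthov form fullv by apply/mem_orthovP => w _.
by rewrite (eqP hform) memv0 => /eqP.
Qed.

Lemma gram_unit : gram \in unitmx.
Proof.
rewrite -row_free_unit -kermx_eq0; apply/eqP/row_matrixP => i; rewrite row0.
apply: trmx_inj; rewrite trmx0; apply: form_eq0 => w.
by rewrite form_gram trmxK -row_mul mulmx_ker row0 mul0mx mxE.
Qed.

Variables (rho : 'M[k]_n -> 'M[k]_n).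
Hypothesis hrho : is_adjoint_involution form rho.

(** The hypothesis says that form (B v) w = form v (A w) for all v and w, which
    by nondegeneracy determines B. *)
Lemma adjoint_eq (A B : 'M[k]_n) : B^T *m gram = gram *m A -> rho A = B.
Proof.
move=> BA; apply/trmx_inj/row_matrixP => i.
rewrite -!tr_col !colE; congr trmx; apply/subr0_eq/form_eq0 => w.
rewrite linearBl /= (hrho A) [X in _ - X]form_gram trmx_mul.
by rewrite form_gram -[_ *m B^T *m gram]mulmxA BA !mulmxA subrr.
Qed.

Lemma adjointE (A : 'M[k]_n) : rho A = (gram *m A *m invmx gram)^T.
Proof. by apply: adjoint_eq; rewrite trmxK mulmxKV ?gram_unit. Qed.

End Adjoint.

(** * Existence of a generating tuple *)

Lemma exists_distinct_scalars (k : closedFieldType) (n : nat) :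
  exists s : 'rV[k]_n, injective (s 0).
Proof.
have [l ul sl] : exists2 l : seq k, uniq l & size l = n.
  elim: n => [|n [l ul <-]]; first by exists [::].
  have : \prod_(x <- l) ('X - x%:P) != 0 by rewrite monic_neq0 ?monic_prod_XsubC.
  case/closed_nonrootP=> x; rewrite root_prod_XsubC => xl.
  by exists (x :: l); rewrite //= xl.
exists (\row_i l`_i) => i j; rewrite !mxE => /eqP.
by rewrite nth_uniq ?sl // => /eqP/val_inj.
Qed.

(** The equation on A and B says that B is the adjoint of A for the form with
    Gram matrix G. *)
Lemma exists_generating_pair (k : closedFieldType) (n : nat)
    (G : 'M[k]_n) :
  2%:R != 0 :> k -> G^T = G -> G \in unitmx ->
  exists A B : 'M[k]_n, B^T *m G = G *m A /\
    forall T, subalgebra T -> T A -> T B -> forall C, T C.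
Proof.
move=> two0 symG Gu.
have [P [d [Pu PE]]] := diagonalize_symmetric two0 symG.
have d0 i : d 0 i != 0.
  have : diag_mx d \in unitmx by rewrite -PE !unitmx_mul unitmx_tr Pu Gu.
  by rewrite unitmxE det_diag unitfE => /prodf_neq0/(_ i isT).
have [s s_inj] := exists_distinct_scalars k n.
pose sg (i j : 'I_n) : k := (i < j)%N%:R - (j < i)%N%:R.
have sgN i j : sg j i = - sg i j by rewrite /sg opprB.
have sg0 i j : i != j -> sg i j != 0.
  rewrite -val_eqE /sg; case: ltngtP => //= _ _.
    by rewrite subr0 oner_eq0.
  by rewrite sub0r oppr_eq0 oner_eq0.
(* The factor d_j turns the skew-symmetry of sg into anti-self-adjointness with
   respect to diag(d). *)
pose K : 'M[k]_n := \matrix_(i, j) (sg i j * d 0 j).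
have KD : - K^T *m diag_mx d = diag_mx d *m K.
  apply/matrixP => i j; rewrite mulNmx mul_mx_diag mul_diag_mx !mxE.
  by rewrite sgN !mulNr opprK [RHS]mulrCA mulrA.
(* The rows of P being the orthogonal basis, this maps a matrix written in that
   basis to the matrix of the same endomorphism in the standard basis. *)
pose conj (C : 'M[k]_n) := P^T *m C *m invmx P^T.
have PTu : P^T \in unitmx by rewrite unitmx_tr.
have conjK C : conj (invmx P^T *m C *m P^T) = C.
  by rewrite /conj !mulmxA mulmxV // mul1mx mulmxK.
exists (conj (diag_mx s + K)), (conj (diag_mx s - K)); split.
  rewrite /conj !trmx_mul trmxK trmx_inv trmxK.
  have GE : P *m G = diag_mx d *m invmx P^T by rewrite -PE mulmxK.
  have GE' : G *m P^T = invmx P *m diag_mx d by rewrite -PE !mulmxA mulVmx ?mul1mx.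
  rewrite -!mulmxA GE !mulmxA GE' -!mulmxA; congr (_ *m _); rewrite !mulmxA.
  congr (_ *m _); rewrite linearB /= tr_diag_mx mulmxDl KD mulmxDr.
  rewrite !mulmx_diag; congr (diag_mx _ + _).
  by apply/rowP => j; rewrite !mxE mulrC.
move=> T algT TA TB C; rewrite -(conjK C).
have conjD A B : conj (A + B) = conj A + conj B by rewrite /conj mulmxDr mulmxDl.
have conjZ c A : conj (c *: A) = c *: conj A.
  by rewrite /conj -scalemxAr -scalemxAl.
have algT' : subalgebra (conj @^-1` T).
  split=> /=.
  - by rewrite /conj mulmx1 mulmxV //; apply: subalgebra1.
  - by move=> A B TA' TB'; rewrite conjD; apply: subalgebraD.
  - by move=> c A TA'; rewrite conjZ; apply: subalgebraZ.
  - move=> A B TA' TB'; have -> : conj (A *m B) = conj A *m conj B.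
      by rewrite /conj !mulmxA mulmxKV.
    exact: subalgebraM.
have half (A : 'M[k]_n) : 2%:R^-1 *: (A + A) = A.
  by rewrite -mulr2n -scaler_nat scalerA mulVf // scale1r.
apply: (subalgebra_full algT' s_inj (K := K)).
- by move=> i j ij; rewrite mxE mulf_neq0 ?sg0.
- have -> : diag_mx s = 2%:R^-1 *: ((diag_mx s + K) + (diag_mx s - K)).
    by rewrite addrACA subrr addr0 half.
  by apply/(subalgebraZ algT')/(subalgebraD algT').
- have -> : K = 2%:R^-1 *: ((diag_mx s + K) + -1 *: (diag_mx s - K)).
    by rewrite scaleN1r opprB addrC addrA subrK half.
  by apply/(subalgebraZ algT')/(subalgebraD algT') => //; apply: subalgebraZ.
Qed.

(** * Generation as a polynomial condition *)

(** The body agrees with the valuation in [generates_with_involution], but over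
    an arbitrary type of entries, so as to apply also to the generic tuple. *)
Definition letters (R : Type) (n r : nat) (rho : 'M[R]_n -> 'M[R]_n)
    (A : 'I_r -> 'M[R]_n) (x : 'I_r + 'I_r) : 'M[R]_n :=
  match x with inl i => A i | inr i => rho (A i) end.

Section GenericTuple.
Variables (k : fieldType) (n r : nat) (G : 'M[k]_n).
Local Notation N := (r * (n * n))%N.

Definition generic_mx (i : 'I_r) : 'M[{mpoly k[N]}]_n :=
  \matrix_(p, q) 'X_(mxvec_index i (mxvec_index p q)).

Definition generic_adjoint (A : 'M[{mpoly k[N]}]_n) : 'M[{mpoly k[N]}]_n :=
  (map_mx (@mpolyC N k) G *m A *m map_mx (@mpolyC N k) (invmx G))^T.

Definition word_det (w : 'I_(n * n) -> seq ('I_r + 'I_r)%type) :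
    {mpoly k[N]} :=
  \det (\matrix_t mxvec (word_mx (letters generic_adjoint generic_mx) (w t))).

Lemma meval_word_det (A : 'I_r -> 'M[k]_n)
    (w : 'I_(n * n) -> seq ('I_r + 'I_r)%type) :
  (word_det w).@[fun i => (entries A : 'rV_N) 0 i] =
  \det (\matrix_t mxvec
    (word_mx (letters (fun B => (G *m B *m invmx G)^T) A) (w t))).
Proof.
set v := fun i => _.
have mapX i : map_mx (meval v) (generic_mx i) = A i.
  apply/matrixP => p q; rewrite !mxE mevalXU /v.
  by rewrite /entries mxvecE mxE mxvecE.
have mapC (B : 'M[k]_n) : map_mx (meval v) (map_mx (@mpolyC N k) B) = B.
  by apply/matrixP => p q; rewrite !mxE mevalC.
rewrite -det_map_mx; congr (\det _); apply/row_matrixP => t.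
rewrite -map_row !rowK map_mxvec map_word_mx; congr (mxvec _).
apply: eq_bigr => -[i|i] _ /=; first exact: mapX.
by rewrite /generic_adjoint -map_trmx !map_mxM !mapC mapX.
Qed.

End GenericTuple.

Theorem corollary4p12 (k : closedFieldType) (hchar : 2%N \notin [pchar k])
    (n r : nat) (hn : (0 < n)%N) (hr : (1 <= r)%N)
    (form : {symmetric 'cV[k]_n}) (hform : nondegenerate form)
    (rho : 'M[k]_n -> 'M[k]_n) (hrho : is_adjoint_involution form rho) :
  open (@entries k n r @` U r rho) /\ dense (@entries k n r @` U r rho).
Proof.
have two0 : 2%:R != 0 :> k by move: hchar; rewrite inE.
pose G := gram form.
have rhoE : rho = fun B => (G *m B *m invmx G)^T.
  by apply/funext => B; apply: adjointE.
(* U is the union of the nonvanishing sets of the polynomials word_det. *)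
have UE : @entries k n r @` U r rho =
    [set x : affine_space k (r * (n * n)) | exists2 p,
      range (word_det (r := r) G) p & p.@[fun i => x 0 i] != 0].
  apply/seteqP; split=> x /=.
    case=> A /generates_words_det[w w0] <-.
    exists (word_det G w); first by exists w.
    by rewrite meval_word_det -rhoE.
  have [e eK Ke] := entries_bij k n r.
  rewrite -(Ke x); case=> _ [w _ <-]; rewrite meval_word_det -rhoE => w0.
  by exists (e x) => //; apply/generates_words_det; exists w.
have Uopen : open (@entries k n r @` U r rho).
  by rewrite UE; apply: open_nonvanishing.
split=> //; apply: dense_open_nonempty => //.
have [A [B [AB gen]]] :=
  exists_generating_pair two0 (gram_sym form) (gram_unit hform).
exists (entries (fun _ => A)), (fun _ => A) => // C.
pose a : ('I_r + 'I_r)%type -> 'M[k]_n := letters rho (fun=> A).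
have alg := subalgebra_ncpoly_eval a.
have letter x : range (ncpoly_eval a) (a x).
  by have := ncpoly_eval_word a [:: x]; rewrite /word_mx big_seq1.
have [p _ <-] : range (ncpoly_eval a) C; last by exists p.
apply: gen => //; first exact: (letter (inl (Ordinal hr))).
by rewrite -(adjoint_eq hform hrho AB); exact: (letter (inr (Ordinal hr))).
Qed.
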